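(* Let $\psi \colon H \to G$ be a balanced homomorphism between topological groups $G$ and $H$. If $H$ is amenable and $\psi (H)$ weakly proximally simulates $G$, then $G$ is skew-amenable.
   Context: For a topological group $G$, let $\mathscr{U}(G)$ be the set of neighborhoods of the neutral element, and for $g\in G$ let $\lambda_g\colon G\to G,\ x\mapsto gx$. $\mathrm{LUCB}(G)$ is the algebra of bounded functions $f\colon G\to\mathbb{R}$ that are left-uniformly continuous, i.e., for every $\epsilon>0$ there is $U\in\mathscr{U}(G)$ with $|f(x)-f(y)|\le\epsilon$ whenever $x^{-1}y\in U$. $\mathrm{RUCB}(G)$ is defined in the same way with $xy^{-1}\in U$ in place of $x^{-1}y\in U$. A mean on one of these algebras is a positive linear functional $\mu$ with $\mu(\mathbf 1)=1$; it is left-invariant if $\mu(f\circ\lambda_g)=\mu(f)$ for all $f$ and all $g\in G$. $G$ is skew-amenable if $\mathrm{LUCB}(G)$ admits a left-invariant mean. $G$ is amenable if every continuous action of $G$ on a non-void compact Hausdorff space admits an invariant regular Borel probability measure (equivalently, $\mathrm{RUCB}(G)$ admits a left-invariant mean). A homomorphism $\psi\colon H\to G$ of topological groups is balanced if $\bigcap_{g\in G}\psi^{-1}(g^{-1}Ug)\in\mathscr{U}(H)$ for every $U\in\mathscr{U}(G)$. A subgroup $K\leq G$ weakly proximally simulates $G$ if for every finite $E\subseteq G$, every finite $F\subseteq\mathrm{LUCB}(G)$ and every $\epsilon>0$ there exists a family $(h_g)_{g\in E}\in K^E$ such that for every finite $S\subseteq K$ there is $t\in G$ with $|f(gst)-f(h_gst)|<\epsilon$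 for all $g\in E$, $s\in S$, $f\in F$. *)

(* Defs.v *)
From HB Require Import structures.
From mathcomp Require Import all_boot all_order all_algebra.
From mathcomp Require Import all_classical all_reals all_analysis.

Set Implicit Arguments.
Unset Strict Implicit.
Unset Printing Implicit Defensive.

Import Order.TTheory GRing.Theory Num.Theory.
Import numFieldNormedType.Exports.

Local Open Scope classical_set_scope.
Local Open Scope ring_scope.

(* The groups are the possibly infinite multiplicative [groupType]s of
   [monoid]; no separation axiom is assumed on the topology. *)
HB.structure Definition PreTopologicalGroup := {G of Topological G & Group G}.

HB.mixin Record PreTopologicalGroup_isTopologicalGroup G
    & PreTopologicalGroup G := {
  mulg_continuous : continuous (fun x : G * G => (x.1 * x.2)%g) ;
  invg_continuous : continuous (fun x : G => (x^-1)%g)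
}.

#[short(type="topologicalGroupType")]
HB.structure Definition TopologicalGroup :=
  {G of PreTopologicalGroup G & PreTopologicalGroup_isTopologicalGroup G}.

Definition LUCB (R : realType) (G : topologicalGroupType) : set (G -> R) :=
  [set f | bounded_fun f /\
    forall eps : R, 0 < eps -> exists2 U : set G, nbhs 1%g U &
      forall x y : G, U (x^-1 * y)%g -> `|f x - f y| <= eps].

(* A functional on the algebra [A] is encoded by a total function on
   [T -> R]; its values outside [A] are irrelevant. *)
Definition is_mean (R : realType) (T : Type) (A : set (T -> R))
    (mu : (T -> R) -> R) : Prop :=
  [/\ forall (a : R) (f g : T -> R), A f -> A g ->
        mu (fun x => a * f x + g x) = a * mu f + mu g,
      forall f : T -> R, A f -> (forall x, 0 <= f x) -> 0 <= mu f
    & mu (cst 1) = 1].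

Definition left_invariant (R : realType) (G : topologicalGroupType)
    (A : set (G -> R)) (mu : (G -> R) -> R) : Prop :=
  forall (f : G -> R) (g : G), A f -> mu (fun x => f (g * x)%g) = mu f.

Definition skew_amenable (R : realType) (G : topologicalGroupType) : Prop :=
  exists2 mu : (G -> R) -> R,
    is_mean (@LUCB R G) mu & left_invariant (@LUCB R G) mu.

Definition continuous_action (G : topologicalGroupType) (X : topologicalType)
    (act : G -> X -> X) : Prop :=
  [/\ forall x : X, act 1%g x = x,
      forall (g h : G) (x : X), act (g * h)%g x = act g (act h x)
    & continuous (fun p : G * X => act p.1 p.2)].

Definition regular_measure (R : realType) (X : ptopologicalType)
    (mu : set X -> \bar R) : Prop :=
  forall B : set X, (@open X).-sigma.-measurable B ->
    mu B = ereal_sup [set mu K | K in [set K | compact K /\ K `<=` B]] /\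
    mu B = ereal_inf [set mu U | U in [set U | open U /\ B `<=` U]].

(* The library's measurable types are pointed, so non-void spaces are
   represented by pointed ones; the base point plays no role. *)
Definition amenable (R : realType) (G : topologicalGroupType) : Prop :=
  forall (X : ptopologicalType) (act : G -> X -> X),
    compact [set: X] -> hausdorff_space X -> continuous_action act ->
    exists2 mu : probability (g_sigma_algebraType (@open X)) R,
      @regular_measure R X mu &
      forall (g : G) (B : set X), (@open X).-sigma.-measurable B ->
        mu (act g @^-1` B) = mu B.

(* [u ^ g] is conjugation, [g^-1 * u * g]. *)
Definition balanced (H G : topologicalGroupType) (psi : H -> G) : Prop :=
  forall U : set G, nbhs 1%g U ->
    nbhs (1%g : H)
      (\bigcap_(g in [set: G]) (psi @^-1` [set (u ^ g)%g | u in U])).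

Definition weakly_proximally_simulates (R : realType)
    (G : topologicalGroupType) (K : set G) : Prop :=
  forall (E : set G) (F : set (G -> R)) (eps : R),
    finite_set E -> finite_set F -> F `<=` @LUCB R G -> 0 < eps ->
    exists2 h : G -> G, (forall g, E g -> K (h g)) &
      forall S : set G, finite_set S -> S `<=` K ->
        exists t : G, forall (g s : G) (f : G -> R), E g -> S s -> F f ->
          `|f (g * s * t)%g - f (h g * s * t)%g| < eps.

(* Main.v *)
From HB Require Import structures.
Require Import Defs.
From mathcomp Require Import all_boot all_order all_algebra.
From mathcomp Require Import all_classical all_reals all_analysis.
From mathcomp Require Import measurable_realfun.

(** A mean on [LUCB G] is invariant as soon as it moves every [f] by at most
    [1] under every translation, because the functions [c * f] satisfy the same
    bound.  Means form a compact set for pointwise convergence, so it suffices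
    to meet finitely many such constraints at once, say for finite sets [E] of
    translations and [F] of functions.

    Weak proximal simulation yields elements [h g = psi (k g)] such that, for
    each finite set [S] of elements of [psi H], evaluation at a suitable [t] is
    a mean whose values at [f (g * s * -)] and [f (h g * s * -)] differ by at
    most [1] for all [s] in [S].  Compactness again replaces these evaluations
    by a single mean [xi] that works for every [s] in [psi H]
    ([simulation_mean]).  Smear [xi] along [H]: to [f] associate the orbit
    function [x |-> xi (f (psi x * -))].  Balancedness makes it right-uniformly
    continuous on [H] ([balanced_orbit_RUCB]), so a left-invariant mean [m] on
    [RUCB H] can be applied to it.  Translating [f] by [g] changes the orbit
    function, up to [1], into its translate by [k g], which [m] does not see:
    the composite mean meets the constraints.

    The mean [m] comes from the action of [H] by translation on the compact
    space of means on [RUCB H].  This action is jointly continuous because right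
    uniform continuity makes [h |-> f (h * -)] continuous for the sup norm.
    Amenability provides an invariant probability measure on the space of means,
    and the barycenter of this measure is an invariant mean
    ([amenable_RUCB_mean]).  Working with [xi] on all of [psi H] at once is what
    avoids approximating [m] by finitely supported measures. *)

Set Implicit Arguments.
Unset Strict Implicit.
Unset Printing Implicit Defensive.

Import Order.TTheory GRing.Theory Num.Theory.
Import numFieldNormedType.Exports.

Local Open Scope classical_set_scope.
Local Open Scope ring_scope.

(** * Means and their compactness *)

Section Means.
Context (R : realType) (T : Type).
Implicit Types (A : set (T -> R)) (mu : (T -> R) -> R) (f g : T -> R).

Definition bounded_function_space A : Prop :=
  [/\ A (cst 1),
      forall (a : R) f g, A f -> A g -> A (fun x => a * f x + g x)
    & forall f, A f -> exists M : R, forall x, `|f x| <= M].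

Lemma bounded_function_space_cst A (c : R) :
  bounded_function_space A -> A (cst c).
Proof.
case=> A1 AD _; have -> : cst c = (fun x : T => (c - 1) * cst 1 x + cst 1 x).
  by apply/funext => x /=; rewrite mulr1 subrK.
exact: AD.
Qed.

Lemma mean_cst A mu (c : R) :
  bounded_function_space A -> is_mean A mu -> mu (cst c) = c.
Proof.
move=> [A1 _ _] [muL _ mu1].
have -> : cst c = (fun x : T => (c - 1) * cst 1 x + cst 1 x).
  by apply/funext => x /=; rewrite mulr1 subrK.
by rewrite muL// mu1 mulr1 subrK.
Qed.

Lemma mean_mono A mu f g : bounded_function_space A -> is_mean A mu ->
  A f -> A g -> (forall x, f x <= g x) -> mu f <= mu g.
Proof.
move=> [_ AD _] [muL mu0 _] Af Ag fg.
rewrite -subr_ge0 addrC -mulN1r -muL//; apply: mu0; first exact: AD.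
by move=> x; rewrite mulN1r addrC subr_ge0.
Qed.

Lemma mean_norm_le A mu f (M : R) : bounded_function_space A ->
  is_mean A mu -> A f -> (forall x, `|f x| <= M) -> `|mu f| <= M.
Proof.
move=> As mumean Af fM; rewrite ler_norml.
rewrite -{1}(mean_cst (- M) As mumean) -{2}(mean_cst M As mumean).
by apply/andP; split; apply: (mean_mono As mumean) => //;
  do ?[exact: bounded_function_space_cst] => x;
  have := fM x; rewrite ler_norml => /andP[].
Qed.

Lemma mean_dist_le A mu f g (M : R) : bounded_function_space A ->
  is_mean A mu -> A f -> A g -> (forall x, `|f x - g x| <= M) ->
  `|mu f - mu g| <= M.
Proof.
move=> As mumean Af Ag fgM.
have [_ AD _] := As; have [muL _ _] := mumean.
rewrite distrC addrC -mulN1r -muL//; apply: (mean_norm_le As) => //.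
  exact: AD.
by move=> x; rewrite mulN1r addrC distrC.
Qed.

Lemma mean_scale A mu (a : R) f :
  bounded_function_space A -> is_mean A mu -> A f ->
  A (fun x => a * f x) /\ mu (fun x => a * f x) = a * mu f.
Proof.
move=> As mumean Af; have [_ AD _] := As; have [muL _ _] := mumean.
have -> : (fun x => a * f x) = (fun x => a * f x + cst 0 x).
  by apply/funext => x; rewrite addr0.
have A0 : A (cst 0) by exact: bounded_function_space_cst.
by split; [exact: AD|rewrite muL// (mean_cst _ As mumean) addr0].
Qed.

Lemma is_mean_eval A (x : T) : is_mean A (fun f => f x).
Proof. by split => // f _; apply. Qed.

(** Requiring the value [0] off [A] discards the irrelevant part of the encoding
    of a mean, which would otherwise be unconstrained and spoil compactness. *)
Definition means A : set {ptws (T -> R) -> R} :=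
  [set xi | is_mean A xi /\ forall f, ~ A f -> xi f = 0].

Definition restrict_mean A mu : {ptws (T -> R) -> R} :=
  fun f => if `[< A f >] then mu f else 0.

Lemma restrict_meanE A mu f : A f -> restrict_mean A mu f = mu f.
Proof. by move=> Af; rewrite /restrict_mean asboolT. Qed.

Lemma restrict_mean_means A mu : bounded_function_space A ->
  is_mean A mu -> means A (restrict_mean A mu).
Proof.
move=> [A1 AD _] [muL mu0 mu1]; split; last first.
  by move=> f nAf; rewrite /restrict_mean asboolF.
split.
- by move=> a f g Af Ag; rewrite !restrict_meanE//; [exact: muL|exact: AD].
- by move=> f Af f0; rewrite restrict_meanE//; exact: mu0.
- by rewrite restrict_meanE.
Qed.

Lemma eval_continuous f :
  continuous (fun xi : {ptws (T -> R) -> R} => xi f).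
Proof. exact: (@proj_continuous _ (fun=> R) f). Qed.

Lemma closed_preimage (D : set R) (phi : {ptws (T -> R) -> R} -> R) :
  closed D -> continuous phi -> closed (phi @^-1` D).
Proof. by move=> cD cphi; apply: preimage_closed cD => xi _; exact: cphi. Qed.

Lemma closed_means A : closed (means A).
Proof.
have forall_closed (I : Type) (P : I -> set {ptws (T -> R) -> R}) :
    (forall i, closed (P i)) -> closed [set xi | forall i, P i xi].
  move=> cP xi cxi i; apply: cP; move: xi cxi; apply: closure_subset.
  by move=> xi; apply.
have closed_eqc (phi psi : {ptws (T -> R) -> R} -> R) : continuous phi ->
    continuous psi -> closed [set xi | phi xi = psi xi].
  move=> cphi cpsi.
  have -> : [set xi | phi xi = psi xi] =
      (fun xi => phi xi - psi xi) @^-1` [set x : R | x = 0].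
    by apply/seteqP; split => xi /= => [->|/subr0_eq]; rewrite ?subrr.
  apply: (@closed_preimage [set x | x = 0] _ (@closed_eq R 0)) => xi.
  exact: (cvgB (cphi xi) (cpsi xi)).
have -> : means A = [set xi | forall a f g, A f -> A g ->
      xi (fun x => a * f x + g x) = a * xi f + xi g] `&`
    [set xi | forall f, A f -> (forall x, 0 <= f x) -> 0 <= xi f] `&`
    [set xi | xi (cst 1) = 1] `&` [set xi | forall f, ~ A f -> xi f = 0].
  by apply/seteqP; split => xi /= => [[[]]|[[[]]]].
apply: closedI; [apply: closedI; [apply: closedI|]|].
- do 5![apply: (@forall_closed) => ?]; apply: closed_eqc.
    exact: eval_continuous.
  move=> xi; apply: (cvgD _ (@eval_continuous _ xi)).
  exact: (cvgM (cvg_cst _) (@eval_continuous _ xi)).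
- do 3![apply: (@forall_closed) => ?].
  apply: (@closed_preimage [set x | 0 <= x] _ (@closed_ge R 0)).
  exact: eval_continuous.
- apply: (closed_eqc (fun xi => xi (cst 1)) (fun=> 1)).
    exact: eval_continuous.
  exact: cst_continuous.
- do 2![apply: (@forall_closed) => ?].
  apply: (closed_eqc (fun xi => xi _) (fun=> 0)).
    exact: eval_continuous.
  exact: cst_continuous.
Qed.

(** A mean is bounded by the sup norm, so [means A] is a closed part of a product
    of segments, compact by Tychonoff. *)
Lemma compact_means A : bounded_function_space A -> compact (means A).
Proof.
move=> As; have [_ _ Ab] := As.
have /choice[M MP] : forall f, exists M : R, A f -> forall x, `|f x| <= M.
  move=> f; have [/Ab[M fM]|nAf] := pselect (A f); first by exists M.
  by exists 0.
pose B f : set R := if `[< A f >] then `[- M f, M f]%classic else [set 0].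
have cB : compact [set xi : {ptws (T -> R) -> R} | forall f, B f (xi f)].
  apply: (@tychonoff _ (fun=> R)) => f; rewrite /B.
  by case: ifP => _; [exact: segment_compact|exact: compact_set1].
apply: subclosed_compact cB _; first exact: closed_means.
move=> xi [ximean xi0] f; rewrite /B; case: asboolP => Af; last exact: xi0.
by rewrite /= in_itv /= -ler_norml; apply: (mean_norm_le As ximean Af (MP _ Af)).
Qed.

(** Each constraint cuts out a closed set of means, and closed sets of a compact
    set with the finite intersection property have a common point.  The bound
    [1] loses no generality, as [u] and [v] can be rescaled. *)
Lemma mean_saturation A (I : Type) (J : set I) (u v : I -> T -> R) :
  bounded_function_space A ->
  (forall i, J i -> A (u i)) -> (forall i, J i -> A (v i)) ->
  (forall D : set I, finite_set D -> D `<=` J ->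
     exists2 mu, is_mean A mu &
       forall i, D i -> `|mu (u i) - mu (v i)| <= 1) ->
  exists2 mu, is_mean A mu & forall i, J i -> `|mu (u i) - mu (v i)| <= 1.
Proof.
move=> As Au Av fin.
pose C i := [set xi : {ptws (T -> R) -> R} | `|xi (u i) - xi (v i)| <= 1].
have closedC i : closed (C i).
  apply: (@closed_preimage [set x | x <= 1] _ (@closed_le R 1)) => xi.
  exact: (cvg_norm (cvgB (@eval_continuous _ xi) (@eval_continuous _ xi))).
pose F := filter_from [set D | finite_set D /\ D `<=` J]
  (fun D => means A `&` [set xi | forall i, D i -> C i xi]).
have FF : ProperFilter F.
  apply: filter_from_proper.
    apply: filter_from_filter; first by exists set0; split.
    move=> D E [fD DJ] [fE EJ]; exists (D `|` E).
      by split; [rewrite finite_setU|move=> i [/DJ|/EJ]].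
    by move=> xi [mxi DE]; split; split => // i ?; apply: DE; [left|right].
  move=> D [fD DJ]; have [mu mumean muD] := fin D fD DJ.
  exists (restrict_mean A mu); split; first exact: restrict_mean_means.
  move=> i Di; rewrite /C /= !restrict_meanE; first exact: muD.
    by apply: Av; exact: DJ.
  by apply: Au; exact: DJ.
have FA : F (means A) by exists set0; [split|move=> xi []].
have [xi [[ximean _] clxi]] := compact_means As FF FA.
exists xi => // i Ji; apply: closedC => V nV; apply: clxi => //.
exists [set i]; first by split => // _ ->.
by move=> zeta [_]; apply.
Qed.

End Means.

(** * Bounded uniformly continuous functions on a group *)

Section UniformAlgebras.
Context (R : realType) (G : topologicalGroupType).

(** [UCB delta] is [LUCB R G] when [delta x y = x^-1 * y]; the two uniformities
    share the proof that their bounded functions form a function space. *)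
Definition UCB (delta : G -> G -> G) : set (G -> R) :=
  [set f | bounded_fun f /\
    forall eps : R, 0 < eps -> exists2 U : set G, nbhs 1%g U &
      forall x y : G, U (delta x y) -> `|f x - f y| <= eps].

Definition RUCB : set (G -> R) := UCB (fun x y => (x * y^-1)%g).

Lemma bounded_funW (f : G -> R) (M : R) :
  (forall x, `|f x| <= M) -> bounded_fun f.
Proof.
move=> fM; exists M; split=> [|N MN x _]; first exact: num_real.
exact: le_trans (fM x) (ltW MN).
Qed.

Lemma UCB_space delta : bounded_function_space (UCB delta).
Proof.
have ubd f : UCB delta f -> exists M : R, forall x, `|f x| <= M.
  by move=> [/pinfty_ex_gt0[M _ fM] _]; exists M => x; exact: fM.
split; [split|move=> a f g Uf Ug|exact: ubd].
- exact: bounded_cst.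
- move=> e e0; exists setT; first exact: filterT.
  by move=> x y _; rewrite subrr normr0 ltW.
have [[M fM] [N gN]] := (ubd f Uf, ubd g Ug).
split.
  apply: (@bounded_funW _ (`|a| * M + N)) => x.
  by rewrite (le_trans (ler_normD _ _))// lerD// normrM ler_wpM2l.
move=> e e0; have a1 : 0 < `|a| + 1 by rewrite ltr_wpDl.
have e2 : 0 < e / 2 by exact: divr_gt0.
have [U nU fU] := Uf.2 (e / 2 / (`|a| + 1)) (divr_gt0 e2 a1).
have [V nV gV] := Ug.2 (e / 2) e2.
exists (U `&` V) => [|x y [/fU fxy /gV gxy]]; first exact: filterI.
have -> : a * f x + g x - (a * f y + g y) = a * (f x - f y) + (g x - g y).
  by rewrite mulrBr opprD addrACA.
rewrite (le_trans (ler_normD _ _))// [leRHS]splitr lerD//.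
rewrite normrM (@le_trans _ _ ((`|a| + 1) * `|f x - f y|))//.
  by rewrite ler_wpM2r// lerDl.
by rewrite mulrC -ler_pdivlMr.
Qed.

Lemma LUCB_space : bounded_function_space (@LUCB R G).
Proof. exact: (UCB_space (fun x y => (x^-1 * y)%g)). Qed.

Lemma RUCB_space : bounded_function_space RUCB.
Proof. exact: UCB_space. Qed.

Lemma LUCB_translate (f : G -> R) (g : G) :
  LUCB f -> LUCB (fun x => f (g * x)%g).
Proof.
move=> Lf; have [_ _ /(_ f Lf)[M fM]] := LUCB_space.
split=> [|e e0]; first exact: (bounded_funW (M := M)).
have [U nU fU] := Lf.2 e e0; exists U => // x y Uxy; apply: fU.
by rewrite invgM -mulgA mulKg.
Qed.

Lemma mulg_continuousl (g : G) : continuous (fun x : G => (g * x)%g).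
Proof.
move=> x; apply: (@cvg_comp _ _ _ (fun x : G => (g, x))
  (fun p : G * G => (p.1 * p.2)%g) _ (nbhs (g, x))).
  by apply: cvg_pair; [exact: cvg_cst|exact: cvg_id].
exact: (@mulg_continuous G (g, x)).
Qed.

Lemma mulg_continuousr (g : G) : continuous (fun x : G => (x * g)%g).
Proof.
move=> x; apply: (@cvg_comp _ _ _ (fun x : G => (x, g))
  (fun p : G * G => (p.1 * p.2)%g) _ (nbhs (x, g))).
  by apply: cvg_pair; [exact: cvg_id|exact: cvg_cst].
exact: (@mulg_continuous G (x, g)).
Qed.

Lemma RUCB_translate (f : G -> R) (g : G) :
  RUCB f -> RUCB (fun x => f (g * x)%g).
Proof.
move=> Rf; have [_ _ /(_ f Rf)[M fM]] := RUCB_space.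
split=> [|e e0]; first exact: (bounded_funW (M := M)).
have [U nU fU] := Rf.2 e e0.
exists [set u | U (g * u * g^-1)%g].
  have cc : continuous (fun u : G => (g * u * g^-1)%g).
    move=> u; apply: (@continuous_comp _ _ _ (fun u : G => (g * u)%g)
      (fun u : G => (u * g^-1)%g)).
      exact: mulg_continuousl.
    exact: mulg_continuousr.
  by apply: (cc 1%g U); rewrite mulg1 mulgV.
by move=> x y /= Uxy; apply: fU; rewrite invgM mulgA -(mulgA g x).
Qed.

Lemma RUCB_untranslate (f : G -> R) (g : G) :
  RUCB (fun x => f (g * x)%g) -> RUCB f.
Proof.
move=> /(@RUCB_translate _ g^-1%g); congr (RUCB _).
by apply/funext => x; rewrite mulVKg.
Qed.

End UniformAlgebras.

(** If [d] is a nonzero defect of invariance at [f], then [2 / d * f] has defect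
    [2]. *)
Lemma approximate_left_invariance (R : realType) (G : topologicalGroupType) mu :
  is_mean (@LUCB R G) mu ->
  (forall (f : G -> R) (g : G), LUCB f ->
     `|mu (fun x => f (g * x)%g) - mu f| <= 1) ->
  left_invariant (@LUCB R G) mu.
Proof.
move=> mumean mu1 f g Lf; apply/eqP; rewrite -subr_eq0; apply/negP => /negP d0.
set d := mu _ - mu f in d0.
have Ls := LUCB_space R G.
have [L2 mu2] := mean_scale (2 / d) Ls mumean Lf.
have [_ mu2g] := mean_scale (2 / d) Ls mumean (LUCB_translate g Lf).
have := mu1 _ g L2; rewrite mu2 mu2g -mulrBr -/d divfK// normr_nat.
by rewrite (ler_nat R 2 1).
Qed.

(** * Subspaces and products of topological spaces *)

Lemma ptws_continuous (I : eqType) (Y V : topologicalType)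
  (f : Y -> {ptws I -> V}) :
  (forall i, continuous (fun y => f y i)) -> continuous f.
Proof.
move=> cf y; apply/cvg_sup => i.
exact: (@continuous_comp_initial _ _ _ (fun h : I -> V => h i) f (cf i)).
Qed.

Lemma continuous_set_type (Y Z : topologicalType) (A : set Z) (f : Y -> A) :
  continuous (fun y => \val (f y)) -> continuous f.
Proof. exact: continuous_comp_initial. Qed.

Lemma compact_set_type (Z : topologicalType) (A : set Z) :
  compact A -> compact [set: A].
Proof.
move=> cA F FF _.
have FA : (\val @ F) A.
  by apply: (@filterS _ F _ setT) filterT => x _; exact: set_valP.
have [p [Ap clp]] := cA (\val @ F) _ FA.
exists (exist _ p (mem_set Ap)); split => // B C FB.
move=> [_ [[W oW <-]] /= Wp WC].
have [q [[x Bx <-]] Wx] : (\val @` B) `&` W !=set0.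
  apply: clp; last by apply: open_nbhs_nbhs; split.
  by apply: (@filterS _ F _ B) FB => x Bx; exists x.
by exists x; split => //; exact: WC.
Qed.

Lemma hausdorff_set_type (Z : topologicalType) (A : set Z) :
  hausdorff_space Z -> hausdorff_space A.
Proof.
move=> hZ x y xy; apply/val_inj/hZ => B C nB nC.
have [z [Bz Cz]] := xy _ _ (@initial_continuous A Z \val x _ nB)
  (@initial_continuous A Z \val y _ nC).
by exists (\val z).
Qed.

(** * Invariant means from invariant measures *)

Lemma Rintegral_invariant (R : realType) d (Y : measurableType d)
    (P : {measure set Y -> \bar R}) (phi : Y -> Y) (F : Y -> R) :
  measurable_fun [set: Y] phi ->
  (forall B, measurable B -> P (phi @^-1` B) = P B) ->
  measurable_fun [set: Y] F ->
  P.-integrable [set: Y] (EFin \o (F \o phi)) ->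
  (\int[P]_(y in [set: Y]) F (phi y) = \int[P]_(y in [set: Y]) F y)%R.
Proof.
move=> mphi Pphi mF iF; rewrite /Rintegral; congr fine.
have mF' : measurable_fun [set: Y] (EFin \o F) by exact/measurable_EFinP.
have := integral_pushforward mphi mF' iF measurableT.
rewrite preimage_setT => <-; apply: eq_measure_integral => B mB _.
exact: Pphi.
Qed.

Lemma continuous_action_section (G : topologicalGroupType)
    (X : topologicalType) (act : G -> X -> X) (g : G) :
  continuous_action act -> continuous (act g).
Proof.
move=> [_ _ cact] x; apply: (@cvg_comp _ _ _ (fun x : X => (g, x))
  (fun p : G * X => act p.1 p.2) _ (nbhs (g, x))).
  by apply: cvg_pair; [exact: cvg_cst|exact: cvg_id].
exact: (cact (g, x)).
Qed.

Section RightUniformMeans.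
Context (R : realType) (H : topologicalGroupType).

Let A : set (H -> R) := @RUCB R H.
Let As : bounded_function_space A := RUCB_space R H.

Definition translate_functional (h : H) (xi : {ptws (H -> R) -> R}) :
  {ptws (H -> R) -> R} := fun f => xi (fun x => f (h * x)%g).

Lemma translate_functional_means (h : H) xi :
  means A xi -> means A (translate_functional h xi).
Proof.
move=> [[xiL xi0 xi1] xiN]; split; [split|].
- by move=> a f g Af Ag; apply: xiL; exact: RUCB_translate.
- by move=> f Af f0; apply: xi0 => //; exact: RUCB_translate.
- exact: xi1.
- by move=> f nAf; apply: xiN => /RUCB_untranslate.
Qed.

Definition mean_action (h : H) (xi : means A) : means A :=
  exist _ (translate_functional h (\val xi))
    (mem_set (translate_functional_means h (set_valP xi))).

(** Write [xi0 (f (h0 * -)) - xi (f (h * -))] as the sum of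
    [xi0 (f (h0 * -)) - xi (f (h0 * -))], small for [xi] pointwise near [xi0],
    and [xi (f (h0 * -)) - xi (f (h * -))], at most the sup distance of the two
    translates of [f], whatever the mean [xi]. *)
Lemma mean_action_continuous : continuous_action mean_action.
Proof.
split.
- move=> xi; apply/val_inj/funext => f /=.
  by congr (\val xi); apply/funext => x; rewrite mul1g.
- move=> g h xi; apply/val_inj/funext => f /=.
  by congr (\val xi); apply/funext => x; rewrite mulgA.
apply: continuous_set_type; apply: ptws_continuous => f [h0 xi0].
(* Off [A] the coordinate is constant, because translates of means on [A] are
   again in [means A]. *)
have [Af|nAf] := pselect (A f); last first.
  have fE (p : H * means A) : \val (mean_action p.1 p.2) f = 0.
    by have [_] := set_valP (mean_action p.1 p.2); apply.
  rewrite (_ : (fun p : H * means A => _) = cst 0); last exact/funext.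
  exact: cst_continuous.
apply/cvgrPdist_le => e e0.
have [V nV fV] := Af.2 (e / 2) (divr_gt0 e0 (ltr0Sn _ _)).
pose f0 x := f (h0 * x)%g.
have nh : \forall h \near h0, V (h0 * h^-1)%g.
  have ch : continuous (fun h : H => (h0 * h^-1)%g).
    move=> h; apply: (@continuous_comp _ _ _ (fun h : H => (h^-1)%g)
      (fun h : H => (h0 * h)%g)).
      exact: invg_continuous.
    exact: mulg_continuousl.
  by apply: (ch h0 V); rewrite mulgV.
have nxi : \forall xi \near xi0, `|\val xi0 f0 - \val xi f0| <= e / 2.
  have cf0 : continuous (fun xi : means A => \val xi f0).
    move=> xi; apply: (@continuous_comp _ _ _ (\val : means A -> _)
      (fun zeta : {ptws (H -> R) -> R} => zeta f0)).
      exact: initial_continuous.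
    exact: eval_continuous.
  by move/cvgrPdist_le : (cf0 xi0); apply; exact: divr_gt0.
exists ([set h | V (h0 * h^-1)%g],
        [set xi : means A | `|\val xi0 f0 - \val xi f0| <= e / 2]); first by split.
move=> [h xi] [/= Vh xiP]; rewrite /translate_functional -/f0.
have -> : \val xi0 f0 - \val xi (fun x => f (h * x)%g) =
  (\val xi0 f0 - \val xi f0) + (\val xi f0 - \val xi (fun x => f (h * x)%g)).
  by rewrite addrA subrK.
rewrite (le_trans (ler_normD _ _))// [leRHS]splitr lerD//.
apply: (mean_dist_le As (set_valP xi).1); do ?exact: RUCB_translate.
by move=> x; apply: fV; rewrite invgM mulgA mulgK.
Qed.

(** The mean is the barycenter of an invariant probability measure on the space
    of means: it sends [f] to the integral of [xi |-> xi f], which is continuous,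
    hence Borel measurable, and bounded. *)
Lemma amenable_RUCB_mean : amenable R H ->
  exists2 m, is_mean A m & left_invariant A m.
Proof.
pose pt : means A := exist (fun xi => xi \in means A) _ (mem_set
  (restrict_mean_means As (is_mean_eval A (1%g : H)))).
pose X : ptopologicalType := HB.pack (means A : Type)
  (Topological.on (means A)) (isPointed.Build (means A) pt).
move=> /(_ X mean_action (compact_set_type (compact_means As))).
case=> [||P _ Pinv]; [|exact: mean_action_continuous|].
  by apply: hausdorff_set_type; apply: hausdorff_product => _; exact: Rhausdorff.
pose Y := g_sigma_algebraType (@open X).
have cev f : continuous (fun xi : X => \val xi f : R).
  move=> xi; apply: (@continuous_comp _ _ _ (\val : means A -> _)
    (fun zeta : {ptws (H -> R) -> R} => zeta f)).
    exact: initial_continuous.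
  exact: eval_continuous.
have mev f : measurable_fun [set: Y] (fun xi : Y => \val xi f : R).
  apply: (measurability _ (RGenOpens.measurableE R)).
  move=> _ [_ [a [b ->] <-]]; rewrite setTI; apply: sub_sigma_algebra.
  by move/continuousP : (cev f); apply; exact: interval_open.
have cact g : continuous (mean_action g).
  exact: continuous_action_section mean_action_continuous.
have PT : P [set: Y] = 1%E by exact: probability_setT.
have iev f :
    A f -> P.-integrable [set: Y] (EFin \o (fun xi : Y => \val xi f : R)).
  move=> Af; apply: measurable_bounded_integrable => //.
    by have : (P [set: Y] < +oo)%E; [rewrite PT ltry|exact].
  have [_ _ /(_ f Af)[M fM]] := As.
  exists M; split=> [|N MN xi _]; first exact: num_real.
  by apply: le_trans (ltW MN); apply: (mean_norm_le As (set_valP xi).1).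
pose m f := (\int[P]_(xi in [set: Y]) (\val xi f : R))%R.
exists m; [split|].
- move=> a f g Af Ag; rewrite /m.
  under eq_Rintegral => xi _ do
    rewrite (let: And3 L _ _ := (set_valP xi).1 in L a f g Af Ag).
  rewrite RintegralD ?RintegralZl//; [exact: iev| |exact: iev].
  exact: (integrableZl measurableT a (iev f Af)).
- move=> f Af f0; apply: Rintegral_ge0 => xi _.
  by have [[_ pos _] _] := set_valP xi; apply: pos.
- rewrite /m; under eq_Rintegral => xi _ do
    rewrite (let: And3 _ _ u := (set_valP xi).1 in u).
  by rewrite Rintegral_cst//; have /= -> := PT; rewrite mulr1.
move=> f g Af; rewrite /m.
have Agf : A (fun x => f (g * x)%g) by exact: RUCB_translate.
apply: (@Rintegral_invariant R _ Y P (mean_action g) (fun xi => \val xi f)).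
- apply: (@measurability _ _ Y Y setT (mean_action g) (@open X) erefl).
  move=> _ [B oB <-]; rewrite setTI.
  by apply: sub_sigma_algebra; move/continuousP : (cact g); apply.
- exact: Pinv.
- exact: mev.
- exact: (iev _ Agf).
Qed.

End RightUniformMeans.

(** * Smearing a mean along a balanced homomorphism *)

Section Orbit.
Context (R : realType) (G H : topologicalGroupType).
Variable psi : UMagmaMorphism.type H G.

(** Left uniform continuity of [f] controls [f (psi x * t) - f (psi y * t)]
    through [(psi y * t)^-1 * (psi x * t)], which is the conjugate of
    [psi (x * y^-1)] by [psi y * t].  Balancedness makes it small when
    [x * y^-1] is, uniformly in [t]; this turns left uniform continuity on [G]
    into right uniform continuity on [H]. *)
Lemma balanced_orbit_RUCB xi (f : G -> R) :
  balanced psi -> is_mean (@LUCB R G) xi -> LUCB f ->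
  RUCB (fun x : H => xi (fun t => f (psi x * t)%g)).
Proof.
move=> bal ximean Lf; have Ls := LUCB_space R G.
have [_ _ /(_ f Lf)[M fM]] := Ls.
split=> [|e e0].
  apply: (bounded_funW (M := M)) => x.
  by apply: (mean_norm_le Ls ximean); [exact: LUCB_translate|].
have [U nU fU] := Lf.2 e e0.
exists (\bigcap_(g in [set: G]) (psi @^-1` [set (u ^ g)%g | u in U])).
  exact: bal.
move=> x y xyU; apply: (mean_dist_le Ls ximean); do ?exact: LUCB_translate.
move=> t; rewrite distrC; apply: fU.
have [u Uu] := xyU (psi y * t)^-1%g I.
rewrite gmulfM gmulfV => /(congr1 (fun z => z ^ (psi y * t))%g).
rewrite -conjgM mulVg conjg1 => uE; move: Uu; rewrite uE conjgE.
by rewrite -!mulgA mulKg.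
Qed.

Lemma balanced_mean m xi : balanced psi -> is_mean (@LUCB R G) xi ->
  is_mean (@RUCB R H) m ->
  is_mean (@LUCB R G) (fun f => m (fun x => xi (fun t => f (psi x * t)%g))).
Proof.
move=> bal ximean [mL m0 m1]; have [xiL xi0 xi1] := ximean; split.
- move=> a f g Lf Lg; rewrite -mL;
    [|exact: (balanced_orbit_RUCB bal ximean Lf)
     |exact: (balanced_orbit_RUCB bal ximean Lg)].
  by congr m; apply/funext => x; apply: xiL; exact: LUCB_translate.
- move=> f Lf f0; apply: m0; first exact: (balanced_orbit_RUCB bal ximean Lf).
  by move=> x; apply: xi0 => //; exact: LUCB_translate.
- by rewrite -[RHS]m1; congr m; apply/funext => x.
Qed.

End Orbit.

(** Simulation gives a point [t] for each finite set of [s]; letting evaluation at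
    [t] become a mean makes the order of quantifiers uniform over all of [K]. *)
Lemma simulation_mean (R : realType) (G : topologicalGroupType) (K E : set G)
    (F : set (G -> R)) :
  weakly_proximally_simulates R K -> finite_set E -> finite_set F ->
  F `<=` @LUCB R G ->
  exists2 h : G -> G, (forall g, E g -> K (h g)) &
    exists2 xi, is_mean (@LUCB R G) xi &
      forall g s f, E g -> K s -> F f ->
        `|xi (fun t => f (g * s * t)%g) - xi (fun t => f (h g * s * t)%g)| <= 1.
Proof.
move=> sim fE fF FL; have [h hK hS] := sim E F 1 fE fF FL ltr01.
exists h => //.
pose J := [set p : G * G * (G -> R) | [/\ E p.1.1, K p.1.2 & F p.2]].
pose u (k : G -> G) (p : G * G * (G -> R)) t := p.2 (k p.1.1 * p.1.2 * t)%g.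
have Lu k p : J p -> LUCB (u k p).
  by move=> [_ _ /FL Lf]; exact: LUCB_translate.
have [|xi ximean xiJ] := mean_saturation (LUCB_space R G) (Lu id) (Lu h).
  move=> D fD DJ.
  have [||t tP] := hS [set p.1.2 | p in D]; first exact: finite_image.
    by move=> _ [p /DJ[_ Kp _] <-].
  exists (fun f => f t); first exact: is_mean_eval.
  move=> p Dp; have [Ep _ Fp] := DJ p Dp.
  by apply/ltW/tP => //; exists p.
by exists xi => // g s f Eg Ks Ff; exact: (xiJ (g, s, f)).
Qed.

Theorem proposition7p5 (R : realType) (H G : topologicalGroupType)
    (psi : UMagmaMorphism.type H G) :
  balanced psi ->
  amenable R H ->
  weakly_proximally_simulates R (range psi) ->
  skew_amenable R G.
Proof.
move=> bal amen sim; have [m mmean minv] := amenable_RUCB_mean amen.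
pose J := [set p : G * (G -> R) | LUCB p.2].
pose u (p : G * (G -> R)) x := p.2 (p.1 * x)%g.
have [| |D fD DJ|nu numean nuinv] :=
  @mean_saturation R G (@LUCB R G) _ J u snd (LUCB_space R G).
- by move=> p Lp; exact: LUCB_translate.
- by [].
- have DL : snd @` D `<=` @LUCB R G by move=> _ [p /DJ Lp <-].
  have [h hK [xi ximean xiP]] :=
    simulation_mean sim (finite_image fst fD) (finite_image snd fD) DL.
  exists (fun f => m (fun x => xi (fun t => f (psi x * t)%g))).
    exact: (balanced_mean bal ximean mmean).
  move=> [g f] Dgf; have Lf : LUCB f by exact: (DJ _ Dgf).
  have Eg : (fst @` D) g by exists (g, f).
  have Ff : (snd @` D) f by exists (g, f).
  have [k _ kE] := hK g Eg.
  (* [h g = psi k], and [m] ignores translation of the orbit function by [k]. *)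
  rewrite -(minv _ k (balanced_orbit_RUCB bal ximean Lf)).
  apply: (mean_dist_le (RUCB_space R H) mmean).
  + exact: (balanced_orbit_RUCB bal ximean (LUCB_translate g Lf)).
  + exact: (RUCB_translate k (balanced_orbit_RUCB bal ximean Lf)).
  + move=> x; rewrite /u/=.
    have := xiP g (psi x) f Eg (imageT psi x) Ff; rewrite -kE -gmulfM.
    by under eq_fun do rewrite -mulgA.
exists nu => //; apply: approximate_left_invariance => // f g Lf.
exact: (nuinv (g, f)).
Qed.
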